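(* Let $H$ be a bipartite graph with bipartition $(V_1,V_2)$ such that $|V_2|\geq 2$ and there are two vertices of $V_1$ each of which is adjacent to every vertex of $V_2$. Then $H$ is forcing, i.e. for every $0<p<1$ and every sequence of graphs $(G_n)_{n\ge1}$ with $|V(G_n)|\to\infty$ satisfying $t_{K_2}(G_n)=(1+o(1))p$ and $t_H(G_n)=(1+o(1))p^{|E(H)|}$, the sequence $(G_n)$ is quasirandom with density $p$.
   Context: All graphs are finite and simple. A homomorphism from $F$ to $G$ is a map $V(F)\to V(G)$ sending edges to edges; $h_F(G)$ is the number of homomorphisms and $t_F(G)=h_F(G)/|V(G)|^{|V(F)|}$. $K_2$ is a single edge. A sequence of graphs $(G_n)$ (with $|V(G_n)|\to\infty$) is quasirandom with density $p$ ($0<p<1$) if for every graph $F$, $t_F(G_n)=(1+o(1))p^{|E(F)|}$ as $n\to\infty$. A graph $H$ is $p$-forcing if every sequence $(G_n)$ with $t_{K_2}(G_n)=(1+o(1))p$ and $t_H(G_n)=(1+o(1))p^{|E(H)|}$ is quasirandom with density $p$; $H$ is forcing if it is $p$-forcing for all $0<p<1$. (The forcing conjecture asserts that a graph is forcing iff it is bipartite and contains a cycle; the graphs $H$ in the claim are bipartite and contain a cycle, so the claim is that the forcing conjecture holds for them.) *)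

(* Defs.v *)
From HB Require Import structures.
From mathcomp Require Import all_boot all_order all_algebra.
From mathcomp Require Import all_classical all_reals all_analysis.
Set Implicit Arguments. Unset Strict Implicit. Unset Printing Implicit Defensive.
Import Order.TTheory GRing.Theory Num.Theory.
Import numFieldNormedType.Exports.
Local Open Scope ring_scope.

Record sgraph := SGraph {
  svert :> finType;
  sadj : rel svert;
  sadj_sym : symmetric sadj;
  sadj_irr : irreflexive sadj }.

Definition nedges (F : sgraph) : nat :=
  #|[set e : {set F} | [exists x : F, exists y : F, sadj x y && (e == [set x; y])]]|.

Definition is_hom (F G : sgraph) (f : {ffun F -> G}) : bool :=
  [forall x : F, forall y : F, sadj x y ==> sadj (f x) (f y)].

Definition hom_count (F G : sgraph) : nat := #|[set f : {ffun F -> G} | is_hom f]|.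

Definition tdens (R : realType) (F G : sgraph) : R :=
  (hom_count F G)%:R / ((#|G| ^ #|F|)%N)%:R.

Lemma K2_sym : symmetric (fun x y : bool => x != y).
Proof. by move=> x y; rewrite eq_sym. Qed.
Lemma K2_irr : irreflexive (fun x y : bool => x != y).
Proof. by move=> x; rewrite eqxx. Qed.
Definition K2 : sgraph := SGraph K2_sym K2_irr.

(* "t_F(G_n) = (1 + o(1)) c"  (c > 0 fixed) : t_F(G_n) / c --> 1 *)
Definition asymp_dens (R : realType) (G : nat -> sgraph) (F : sgraph) (c : R) : Prop :=
  ((fun n => tdens R F (G n) / c) @ \oo --> (1 : R))%classic.

Definition order_to_infty (G : nat -> sgraph) : Prop :=
  forall M : nat, exists N : nat, forall n : nat, (N <= n)%N -> (M <= #|G n|)%N.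

Definition quasirandom (R : realType) (G : nat -> sgraph) (p : R) : Prop :=
  forall F : sgraph, asymp_dens G F (p ^+ nedges F).

Definition p_forcing (R : realType) (H : sgraph) (p : R) : Prop :=
  forall G : nat -> sgraph,
    order_to_infty G ->
    asymp_dens G K2 p ->
    asymp_dens G H (p ^+ nedges H) ->
    quasirandom G p.

Definition forcing (R : realType) (H : sgraph) : Prop :=
  forall p : R, 0 < p < 1 -> p_forcing H p.

(* Main.v *)
(** With f the adjacency kernel of G and p its density, resample the
coordinates outside B := V2: t_H becomes the average over y in G^B of the
product, over the vertices w of V1, of the normalised codegrees d(y_{N(w)}).
One vertex with N(w) = B is used to tilt the measure: pick x with probability
proportional to its degree and the y_j independently in its neighbourhood.
Then t_H / p^e(H) is the expectation of a product under this probability, and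
z >= 1 + ln z bounds it below by 1 plus a sum of expected logarithms. The
degree factor contributes the relative entropy of deg / p; each factor d(y_A)
contributes at least the relative entropy of the law of y_A, by ln z <= z - 1.
The second vertex with N(w) = B supplies the entropy of the law of y_B itself.
So t_H close to p^e(H) forces both entropies to be small, hence deg is close
to p and, as |B| >= 2, codegrees of pairs are close to p^2, in L1. Cauchy-
Schwarz then bounds every cut of f - p, and the counting lemma gives
quasirandomness. *)
Require Import Defs.
From HB Require Import structures.
From mathcomp Require Import all_boot all_order all_algebra.
From mathcomp Require Import all_classical all_reals all_analysis.
From mathcomp Require Import ring lra zify.
Set Implicit Arguments. Unset Strict Implicit. Unset Printing Implicit Defensive.
Import Order.TTheory GRing.Theory Num.Theory.
Import numFieldNormedType.Exports.
Local Open Scope ring_scope.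

(** * Averages over finite types *)

HB.lock Definition avg (R : realType) (T : finType) (F : T -> R) : R :=
  (\sum_x F x) / #|T|%:R.

Notation "\avg_ ( x ) F" := (avg (fun x => F))
  (at level 36, F at level 36, x name, format "\avg_ ( x )  F").
Notation "\avg_ ( x : T ) F" := (avg (fun x : T => F))
  (at level 36, F at level 36, x name, only parsing).

Section Average.
Variables (R : realType) (T : finType).
Implicit Types (F K : T -> R) (c : R).

Lemma eq_avg F K : F =1 K -> avg F = avg K.
Proof. by move=> FK; rewrite avg.unlock; congr (_ / _); apply: eq_bigr. Qed.

Lemma avgD F K : \avg_(x) (F x + K x) = avg F + avg K.
Proof. by rewrite avg.unlock big_split mulrDl. Qed.

Lemma avgZl c F : \avg_(x) (c * F x) = c * avg F.
Proof. by rewrite avg.unlock -mulr_sumr mulrA. Qed.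

Lemma avgZr c F : \avg_(x) (F x * c) = avg F * c.
Proof. by rewrite avg.unlock -mulr_suml mulrAC. Qed.

Lemma avgN F : \avg_(x) (- F x) = - avg F.
Proof. by rewrite avg.unlock sumrN mulNr. Qed.

Lemma avgB F K : \avg_(x) (F x - K x) = avg F - avg K.
Proof. by rewrite avgD avgN. Qed.

Lemma avg_sum (I : Type) (r : seq I) (P : pred I) (F : I -> T -> R) :
  \avg_(x) (\sum_(i <- r | P i) F i x) = \sum_(i <- r | P i) avg (F i).
Proof. by rewrite avg.unlock exchange_big mulr_suml. Qed.

Lemma avg_cst c : (0 < #|T|)%N -> \avg_(x : T) c = c.
Proof.
move=> T0; rewrite avg.unlock sumr_const -(mulr_natr c) mulfK// pnatr_eq0.
by rewrite -lt0n.
Qed.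

Lemma ler_avg F K : (forall x, F x <= K x) -> avg F <= avg K.
Proof.
by move=> FK; rewrite avg.unlock ler_wpM2r ?invr_ge0 ?ler0n//; apply: ler_sum.
Qed.

Lemma avg_ge0 F : (forall x, 0 <= F x) -> 0 <= avg F.
Proof. by move=> F0; rewrite avg.unlock divr_ge0// sumr_ge0. Qed.

Lemma avg_le1 F : (forall x, F x <= 1) -> avg F <= 1.
Proof.
move=> F1; have [T0|T0] := posnP #|T|.
  by rewrite avg.unlock T0 invr0 mulr0 ler01.
by rewrite (le_trans (ler_avg F1))// avg_cst.
Qed.

Lemma ler_norm_avg F : `|avg F| <= \avg_(x) `|F x|.
Proof.
rewrite avg.unlock normrM (ger0_norm (x := _^-1)) ?invr_ge0 ?ler0n//.
by rewrite ler_wpM2r ?invr_ge0 ?ler0n// ler_norm_sum.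
Qed.

Lemma avg_gt0 F x : (forall x, 0 <= F x) -> 0 < F x -> 0 < avg F.
Proof.
move=> F0 Fx; rewrite avg.unlock divr_gt0//.
  by rewrite (bigD1 x)//= ltr_pwDl// sumr_ge0.
by rewrite ltr0n; apply/card_gt0P; exists x.
Qed.

Lemma exchange_avg (S : finType) (F : T -> S -> R) :
  \avg_(x) \avg_(y) F x y = \avg_(y) \avg_(x) F x y.
Proof. by rewrite avg.unlock -!mulr_suml exchange_big mulrAC. Qed.

End Average.

(* Cauchy-Schwarz against a function bounded by 1, linearised by AM-GM so that
no square root occurs. *)
Lemma avg_mul_le (R : realType) (T : finType) (b u : T -> R) (e : R) :
  0 < e -> (forall x, `|b x| <= 1) ->
  \avg_(x) (u x ^+ 2) <= e ^+ 2 -> `|\avg_(x) (b x * u x)| <= e.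
Proof.
move=> e0 b1 ue; apply: le_trans (ler_norm_avg _) _.
have h x : `|b x * u x| <= u x ^+ 2 * (2 * e)^-1 + e / 2.
  rewrite normrM; apply: (@le_trans _ _ `|u x|).
    by rewrite ler_piMl.
  rewrite -(ler_pM2r (x := 2 * e)); last by rewrite mulr_gt0.
  rewrite [leRHS]mulrDl divfK; last by rewrite mulf_neq0 ?gt_eqF.
  rewrite -(real_normK (num_real (u x))).
  have : 0 <= (`|u x| - e) ^+ 2 by exact: sqr_ge0.
  by rewrite sqrrB; lra.
apply: le_trans (ler_avg h) _.
rewrite avgD avgZr.
have : \avg_(x : T) (e / 2) <= e / 2.
  have [T0|T0] := posnP #|T|; last by rewrite avg_cst.
  by rewrite avg.unlock T0 invr0 mulr0; lra.
have : avg (fun x => u x ^+ 2) * (2 * e)^-1 <= e / 2.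
  rewrite ler_pdivrMr; last by rewrite mulr_gt0.
  by rewrite (le_trans ue)// expr2; lra.
lra.
Qed.

(** * Resampling coordinates *)

Definition upd (I : finType) (T : Type) (phi : {ffun I -> T}) (i : I) (x : T)
  : {ffun I -> T} := [ffun k => if k == i then x else phi k].

(** Measurability with respect to the coordinates in [A]. Independence can then be expressed while
    all averages stay over one product space. *)
Definition depends_on (I : finType) (T S : Type) (A : {set I})
    (Q : {ffun I -> T} -> S) : Prop :=
  forall phi psi : {ffun I -> T}, {in A, phi =1 psi} -> Q phi = Q psi.

Section Resample.
Variables (R : realType) (I T : finType).
Hypothesis T0 : (0 < #|T|)%N.
Implicit Types (phi : {ffun I -> T}) (Q : {ffun I -> T} -> R).

Lemma updE phi i x : upd phi i x i = x.
Proof. by rewrite ffunE eqxx. Qed.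

Lemma upd_neq phi i x k : k != i -> upd phi i x k = phi k.
Proof. by rewrite ffunE => /negPf ->. Qed.

Lemma card_ffun_gt0 : (0 < #|{ffun I -> T}|)%N.
Proof. by rewrite card_ffun expn_gt0 T0. Qed.

(** Exchanging the value at [i] with a fresh [x] is an involution on the pairs [(phi, x)], so
    resampling one coordinate preserves the uniform measure. *)
Lemma avg_upd i Q : avg Q = \avg_(phi) \avg_(x) Q (upd phi i x).
Proof.
rewrite avg.unlock -mulr_suml; congr (_ / _).
rewrite pair_big/=.
pose h (q : {ffun I -> T} * T) := (upd q.1 i q.2, q.1 i).
have hK : involutive h.
  move=> [phi x]; rewrite /h/= updE; congr (_, _).
  apply/ffunP => k; rewrite ffunE; case: eqVneq => [->//|ki].
  by rewrite upd_neq.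
rewrite (reindex_inj (inv_inj hK))/=.
rewrite [in RHS](eq_bigr (fun q => Q q.1)) => [|q _]; last first.
  by congr Q; case: q (hK q) => phi x [].
rewrite -(pair_big xpredT xpredT (fun phi _ => Q phi))/=.
under [in RHS]eq_bigr => phi _ do rewrite sumr_const -(mulr_natr (Q phi)).
by rewrite -mulr_suml (eq_card (B := T))// mulfK// pnatr_eq0 -lt0n.
Qed.

Lemma depends_upd A Q i phi x :
  depends_on A Q -> i \notin A -> Q (upd phi i x) = Q phi.
Proof.
move=> QA iA; apply: QA => k kA; rewrite upd_neq//.
by apply: contraNneq iA => <-.
Qed.

Lemma avg_coord i (F : T -> R) : \avg_(phi : {ffun I -> T}) F (phi i) = avg F.
Proof.
rewrite (avg_upd i); under eq_avg => phi do under eq_avg => x do rewrite updE.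
by rewrite avg_cst// card_ffun_gt0.
Qed.

Lemma avg_coord2 i j (F : T -> T -> R) : i != j ->
  \avg_(phi : {ffun I -> T}) F (phi i) (phi j) = \avg_(x) \avg_(y) F x y.
Proof.
move=> ij; rewrite (avg_upd j).
under eq_avg => phi do under eq_avg => x do rewrite updE upd_neq//.
exact: (avg_coord i (fun x => \avg_(y) F x y)).
Qed.

Lemma avg_mul_coord i (F : T -> R) Q (A : {set I}) :
  depends_on A Q -> i \notin A ->
  \avg_(phi : {ffun I -> T}) (F (phi i) * Q phi) = avg F * avg Q.
Proof.
move=> QA iA; rewrite (avg_upd i).
under eq_avg => phi.
  under eq_avg => x do rewrite updE (depends_upd _ _ QA)//.
  rewrite avgZr; over.
by rewrite avgZl.
Qed.

End Resample.

(** * Relative entropy *)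

(** When [z] is nonnegative with average 1, the average of [ent z] is the relative entropy of the
    density [z] with respect to the uniform law. The correction [- z + 1] makes the integrand itself
    nonnegative. *)
Definition ent (R : realType) (z : R) : R := z * ln z - z + 1.

Lemma ln_le_sub1 (R : realType) (z : R) : 0 < z -> ln z <= z - 1.
Proof.
by move=> z0; rewrite -{1}(subrKC 1 z) le_ln1Dx// ltrBrDr addNr.
Qed.

(* Apply [ln_le_sub1] to the inverse square root of [z]. *)
Lemma ent_ge_sqr (R : realType) (z : R) :
  0 <= z -> (Num.sqrt z - 1) ^+ 2 <= ent z.
Proof.
rewrite le_eqVlt => /predU1P[<-|z0].
  by rewrite sqrtr0 /ent mul0r; lra.
set s := Num.sqrt z.
have s0 : 0 < s by rewrite sqrtr_gt0.
have zE : z = s ^+ 2 by rewrite sqr_sqrtr// ltW.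
have : ln s^-1 <= s^-1 - 1 by rewrite ln_le_sub1// invr_gt0.
rewrite lnV// => /(ler_wpM2l (ltW s0)) h.
have {}h : s - 1 <= s * ln s by move: h; rewrite mulrBr mulfV ?gt_eqF//; lra.
rewrite /ent zE lnXn//; move: (ler_wpM2l (ltW s0) h).
by rewrite -mulr_natr !expr2; lra.
Qed.

Lemma ent_ge0 (R : realType) (z : R) : 0 <= z -> 0 <= ent z.
Proof. by move=> /ent_ge_sqr; apply: le_trans; exact: sqr_ge0. Qed.

(** A pointwise Pinsker inequality. With [s] the square root of [z], [|z - 1|] equals
    [|s - 1| (s + 1)]; AM-GM with weight [e] separates the two factors, and
    [(s + 1)^2 <= 2 (z + 1)]. *)
Lemma abs_sub1_le_ent (R : realType) (z e : R) : 0 <= z -> 0 < e ->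
  `|z - 1| <= ent z * (2 * e)^-1 + e * (z + 1).
Proof.
move=> z0 e0; have := ent_ge_sqr z0; set s := Num.sqrt z => h.
have s0 : 0 <= s by exact: sqrtr_ge0.
have zE : z = s ^+ 2 by rewrite sqr_sqrtr.
have e2 : 0 < 2 * e by rewrite mulr_gt0.
rewrite -(ler_pM2r e2) [leRHS]mulrDl divfK ?gt_eqF//.
apply: (@le_trans _ _ ((s - 1) ^+ 2 + e * (z + 1) * (2 * e))); last first.
  by rewrite lerD2r.
have -> : z - 1 = (s - 1) * (s + 1) by rewrite zE; ring.
rewrite normrM (ger0_norm (x := s + 1)) ?addr_ge0//.
rewrite -(real_normK (num_real (s - 1))); set a := `|_|.
have : 0 <= (a - e * (s + 1)) ^+ 2 by exact: sqr_ge0.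
have : 0 <= (e * (s - 1)) ^+ 2 by exact: sqr_ge0.
by rewrite zE; lra.
Qed.

Lemma avg_abs_sub1_le_ent (R : realType) (T : finType) (z : T -> R) (e : R) :
  (0 < #|T|)%N -> (forall x, 0 <= z x) -> avg z = 1 -> 0 < e ->
  \avg_(x) ent (z x) <= e ^+ 2 -> \avg_(x) `|z x - 1| <= 3 * e.
Proof.
move=> T0 z0 z1 e0 he.
apply: le_trans (ler_avg (fun x => abs_sub1_le_ent (z0 x) e0)) _.
rewrite avgD avgZr avgZl avgD z1 avg_cst//.
(* The other term is [2 * e], since [z + 1] averages to 2; the sum stays below [3 * e]. *)
have : avg (fun x => ent (z x)) * (2 * e)^-1 <= e / 2.
  rewrite ler_pdivrMr ?mulr_gt0//.
  by rewrite (le_trans he)// expr2; lra.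
lra.
Qed.

(** * Stars in a kernel *)

Section Kernel.
Variables (R : realType) (T : finType) (f : T -> T -> R).
Hypothesis T0 : (0 < #|T|)%N.
Hypothesis f_ge0 : forall x y, 0 <= f x y.
Hypothesis f_le1 : forall x y, f x y <= 1.
Hypothesis f_sym : forall x y, f x y = f y x.

Definition deg (x : T) : R := \avg_(y) f x y.
Definition dens : R := \avg_(x) deg x.

Hypothesis p_gt0 : 0 < dens.
Local Notation p := dens.

Lemma deg_ge0 x : 0 <= deg x.
Proof. exact: avg_ge0. Qed.

Lemma deg_le1 x : deg x <= 1.
Proof. exact: avg_le1. Qed.

Lemma dens_le1 : p <= 1.
Proof. by apply: avg_le1 => x; exact: deg_le1. Qed.

Lemma deg_gt0 x y : 0 < f x y -> 0 < deg x.
Proof. by move=> h; apply: (@avg_gt0 _ _ (f x) y). Qed.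

Lemma avg_deg_div : \avg_(x) (deg x / p) = 1.
Proof. by rewrite avgZr mulfV ?gt_eqF. Qed.

Section Stars.
Variable I : finType.
Implicit Types (A B : {set I}) (phi : {ffun I -> T}).

Definition star A x phi : R := \prod_(j in A) f x (phi j).
Definition cod A phi : R := \avg_(x) star A x phi.

(* Density of the law of a degree-biased vertex x together with #|A|
independent uniform neighbours of x; since x / 0 = 0 it vanishes when x is
isolated. *)
Definition nu A x phi : R := star A x phi / (p * deg x ^+ #|A|.-1).
(** The law of the sampled neighbours alone, with [x] integrated out. *)
Definition mu A phi : R := \avg_(x) nu A x phi.

Lemma star_ge0 A x phi : 0 <= star A x phi.
Proof. by apply: prodr_ge0 => j _. Qed.

Lemma nu_ge0 A x phi : 0 <= nu A x phi.
Proof.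
by rewrite divr_ge0 ?star_ge0// mulr_ge0 ?(ltW p_gt0)// exprn_ge0 ?deg_ge0.
Qed.

Lemma mu_ge0 A phi : 0 <= mu A phi.
Proof. by apply: avg_ge0 => x; exact: nu_ge0. Qed.

Lemma star_eqVgt0 A x phi : star A x phi = 0 \/ 0 < star A x phi.
Proof.
by have := star_ge0 A x phi; rewrite le_eqVlt => /predU1P[<-|]; [left|right].
Qed.

Lemma star_deg_gt0 A x phi : A != finset.set0 -> 0 < star A x phi -> 0 < deg x.
Proof.
move=> /set0Pn[j jA] s0; apply: (@deg_gt0 x (phi j)).
rewrite lt_neqAle f_ge0 andbT eq_sym; apply: contraTneq s0 => fj.
by rewrite /star (bigD1 j)//= fj mul0r ltxx.
Qed.

Lemma star_deg0 A x phi : A != finset.set0 -> deg x = 0 -> star A x phi = 0.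
Proof.
move=> An d0; case: (star_eqVgt0 A x phi) => // /(star_deg_gt0 An).
by rewrite d0 ltxx.
Qed.

Lemma star_sub_gt0 A B x phi :
  A \subset B -> 0 < star B x phi -> 0 < star A x phi.
Proof.
move=> AB; rewrite {1}/star (big_setID A)/= (finset.setIidPr AB) -/(star A x phi).
case: (star_eqVgt0 A x phi) => [->|//]; by rewrite mul0r ltxx.
Qed.

Lemma star_cod_gt0 A x phi : 0 < star A x phi -> 0 < cod A phi.
Proof. by move=> h; apply: (@avg_gt0 _ _ (star A ^~ phi) x) => // y; exact: star_ge0. Qed.

Lemma star_nu_gt0 A x phi : A != finset.set0 -> 0 < star A x phi -> 0 < nu A x phi.
Proof.
move=> An s0; rewrite divr_gt0// mulr_gt0// exprn_gt0//.
exact: star_deg_gt0 An s0.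
Qed.

Lemma star_depends A x : depends_on A (star A x).
Proof. by move=> phi psi h; apply: eq_bigr => j /h ->. Qed.

Lemma cod_depends A : depends_on A (cod A).
Proof. by move=> phi psi h; apply: eq_avg => x; exact: star_depends. Qed.

Lemma nu_depends A x : depends_on A (nu A x).
Proof. by move=> phi psi h; rewrite /nu (star_depends x h). Qed.

Lemma mu_depends A : depends_on A (mu A).
Proof. by move=> phi psi h; apply: eq_avg => x; exact: nu_depends. Qed.

(** For fixed [x] the coordinates in [A] are independent of those in [B]; they are resampled one at
    a time, each giving a factor [deg x]. *)
Lemma avg_star_mul A B x (Q : {ffun I -> T} -> R) :
  depends_on B Q -> [disjoint A & B] ->
  \avg_(phi) (star A x phi * Q phi) = deg x ^+ #|A| * avg Q.
Proof.
move=> QB; move: {2}#|A| (erefl #|A|) => n.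
elim: n A => [|n IH] A An AB.
  move: (An) => /eqP; rewrite cards_eq0 => /eqP ->.
  rewrite finset.cards0 expr0 mul1r; apply: eq_avg => phi.
  by rewrite /star big_set0 mul1r.
have /card_gt0P[i iA] : (0 < #|A|)%N by rewrite An.
have iB : i \notin B by rewrite (disjointFr AB).
have Ai : #|A :\ i| = n by move: An; rewrite (cardsD1 i) iA => -[].
have AiB : [disjoint A :\ i & B] by apply: disjointWl AB; exact: finset.subD1set.
under eq_avg => phi do
  rewrite /star (big_setD1 i)//= -mulrA -/(star (A :\ i) x phi).
rewrite (avg_mul_coord T0 (f x) (A := A :\ i :|: B)).
- by rewrite IH// An Ai exprS mulrA.
- move=> phi psi h; rewrite (star_depends x (A := A :\ i) (psi := psi)).
    by congr (_ * _); apply: QB => j jB; apply: h; rewrite !inE jB orbT.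
  by move=> j jA; apply: h; rewrite inE jA.
- by rewrite !inE eqxx.
Qed.

Lemma avg_star A x : \avg_(phi) star A x phi = deg x ^+ #|A|.
Proof.
have := @avg_star_mul A finset.set0 x (fun=> 1).
rewrite avg_cst ?card_ffun_gt0// mulr1 => <- //.
  by apply: eq_avg => phi; rewrite mulr1.
by rewrite -finset.setI_eq0 finset.setI0.
Qed.

Lemma avg_nu A x : A != finset.set0 -> \avg_(phi) nu A x phi = deg x / p.
Proof.
rewrite -card_gt0 => An; rewrite avgZr avg_star.
case: #|A| An => // a _; rewrite exprS.
have [->|d0] := eqVneq (deg x) 0; first by rewrite !mul0r.
by rewrite invfM mulrCA -mulrA mulrCA mulfV ?mulr1 1?mulrC// expf_neq0.
Qed.

(** Consistency of marginals: given [x], the coordinates in [B] outside [A] integrate to a power of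
    [deg x] that cancels against the normalisation. Nonemptiness of [A] makes the truncated
    predecessors in the exponents match. *)
Lemma avg_nu_mul A B x (Q : {ffun I -> T} -> R) :
  A != finset.set0 -> A \subset B -> depends_on A Q ->
  \avg_(phi) (nu B x phi * Q phi) = \avg_(phi) (nu A x phi * Q phi).
Proof.
move=> An AB QA.
have Bn : B != finset.set0 by apply: contraNneq An => B0; rewrite -finset.subset0 -B0.
have [d0|d0] := eqVneq (deg x) 0.
  by apply: eq_avg => phi; rewrite /nu !star_deg0// !mul0r.
transitivity (\avg_(phi) (star (B :\: A) x phi *
    (star A x phi * Q phi * (p * deg x ^+ #|B|.-1)^-1))).
  apply: eq_avg => phi; rewrite /nu /star (big_setID A)/= (finset.setIidPr AB).
  by ring.
rewrite (@avg_star_mul _ A); last 2 first.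
- by move=> phi psi h; rewrite (star_depends x h) (QA _ _ h).
- by rewrite finset.disjoints_subset; apply/fintype.subsetP => i; rewrite !inE => /andP[].
rewrite -avgZl; apply: eq_avg => phi.
have -> : #|B|.-1 = (#|B :\: A| + #|A|.-1)%N.
  rewrite -(cardsID A B) (finset.setIidPr AB).
  by move: An; rewrite -card_gt0; lia.
rewrite /nu exprD; field; rewrite !expf_neq0// gt_eqF//.
Qed.

Lemma avg_mu A : A != finset.set0 -> \avg_(phi) mu A phi = 1.
Proof.
move=> An; rewrite /mu exchange_avg -avg_deg_div.
by apply: eq_avg => x; exact: avg_nu.
Qed.


(** * Entropy lower bounds *)

Definition deg_ent : R := \avg_(x) ent (deg x / p).

Lemma deg_ent_ge0 : 0 <= deg_ent.
Proof.
by apply: avg_ge0 => x; rewrite ent_ge0// divr_ge0 ?deg_ge0// ltW.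
Qed.

Lemma avg_ent (S : finType) (z : S -> R) : (0 < #|S|)%N -> avg z = 1 ->
  \avg_(x) (z x * ln (z x)) = \avg_(x) ent (z x).
Proof. by move=> S0 z1; rewrite /ent avgD avgB z1 avg_cst//; ring. Qed.

Lemma avg_nu_ln_deg A : A != finset.set0 ->
  \avg_(x) \avg_(phi) (nu A x phi * ln (deg x / p)) = deg_ent.
Proof.
move=> An; rewrite /deg_ent -avg_ent ?avg_deg_div//.
by apply: eq_avg => x; rewrite avgZr avg_nu.
Qed.

Lemma avg_avg_nu A : A != finset.set0 -> \avg_(x) \avg_(phi) nu A x phi = 1.
Proof. by move=> An; rewrite exchange_avg avg_mu. Qed.

(** Pointwise Gibbs inequality. The normalised codegree is [mu * (deg / p)^a / z], where [z] is
    chosen so that [nu * z] is [star * mu / cod]; then [ln z <= z - 1] is applied. Where the star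
    vanishes, both sides are 0. *)
Lemma nu_ln_cod_ge A x phi : A != finset.set0 ->
  nu A x phi * ln (mu A phi)
    + (#|A|.-1)%:R * (nu A x phi * ln (deg x / p))
    - star A x phi * (mu A phi / cod A phi) + nu A x phi
  <= nu A x phi * ln (cod A phi / p ^+ #|A|).
Proof.
move=> An; case: (star_eqVgt0 A x phi) => [s0|s0].
  by rewrite /nu s0; lra.
have d0 := star_deg_gt0 An s0.
have c0 := star_cod_gt0 s0.
have n0 := star_nu_gt0 An s0.
have m0 : 0 < mu A phi.
  apply: (@avg_gt0 _ _ (nu A ^~ phi) x) => // y; exact: nu_ge0.
set a := #|A|.-1; have AE : #|A| = a.+1 by rewrite prednK// card_gt0.
set z := mu A phi * (p * deg x ^+ a) / cod A phi.
have da0 : 0 < deg x ^+ a by rewrite exprn_gt0.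
have z0 : 0 < z by rewrite divr_gt0// mulr_gt0// mulr_gt0.
have -> : star A x phi * (mu A phi / cod A phi) = nu A x phi * z.
  rewrite /nu -/a /z; field.
  by rewrite !gt_eqF// exprn_gt0.
have -> : cod A phi / p ^+ #|A| = mu A phi * (deg x / p) ^+ a / z.
  rewrite AE /z exprMn exprVn exprS; field.
  by rewrite !gt_eqF// exprn_gt0.
have dp0 : 0 < deg x / p by rewrite divr_gt0.
have dpa0 : 0 < (deg x / p) ^+ a by rewrite exprn_gt0.
rewrite [leRHS](_ : _ = nu A x phi *
    (ln (mu A phi) + ln (deg x / p) * a%:R - ln z)); last first.
  have mdp0 := mulr_gt0 m0 dpa0.
  by rewrite ln_div ?posrE// lnM ?posrE// lnXn// mulr_natr.
have := ln_le_sub1 z0; rewrite -(ler_pM2l n0); lra.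
Qed.

Lemma avg_nu_ln_cod_ge A : A != finset.set0 ->
  \avg_(phi) ent (mu A phi) + (#|A|.-1)%:R * deg_ent <=
  \avg_(x) \avg_(phi) (nu A x phi * ln (cod A phi / p ^+ #|A|)).
Proof.
move=> An.
apply: (@le_trans _ _ (\avg_(x) \avg_(phi) (nu A x phi * ln (mu A phi)
    + (#|A|.-1)%:R * (nu A x phi * ln (deg x / p))
    - star A x phi * (mu A phi / cod A phi) + nu A x phi))); last first.
  by do 2 apply: ler_avg => ?; exact: nu_ln_cod_ge.
under [leRHS]eq_avg => x do rewrite avgD avgB avgD avgZl.
rewrite avgD avgB avgD avgZl avg_nu_ln_deg// avg_avg_nu//.
rewrite [X in _ <= X + _ - _ + _]exchange_avg.
under [X in _ <= X + _ - _ + _]eq_avg => phi do rewrite avgZr.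
rewrite avg_ent ?card_ffun_gt0 ?avg_mu//.
(* Averaging the star over [x] first turns the integrand into [mu] where the codegree is nonzero and
   into 0 elsewhere, hence a bound rather than an equality. *)
suff : \avg_(x) \avg_(phi) (star A x phi * (mu A phi / cod A phi)) <= 1 by lra.
rewrite exchange_avg -(avg_mu An); apply: ler_avg => phi.
rewrite avgZr -/(cod A phi) mulrCA.
have [->|c0] := eqVneq (cod A phi) 0; first by rewrite mul0r mulr0 mu_ge0.
by rewrite mulfV// mulr1.
Qed.

(** By consistency of marginals [nu B] may be replaced by [nu A], and the entropy bound is then a
    sum of nonnegative terms. An empty [A] is treated apart: its codegree is 1. *)
Lemma avg_nu_ln_cod_sub A B : A \subset B -> B != finset.set0 ->
  0 <= \avg_(x) \avg_(phi) (nu B x phi * ln (cod A phi / p ^+ #|A|)).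
Proof.
move=> AB Bn; have [->|An] := eqVneq A finset.set0.
  apply: avg_ge0 => x; apply: avg_ge0 => phi.
  have -> : cod finset.set0 phi = 1.
    rewrite /cod; under eq_avg => y do rewrite /star big_set0.
    exact: avg_cst.
  by rewrite finset.cards0 expr0 divr1 ln1 mulr0.
under eq_avg => x.
  rewrite (avg_nu_mul (A := A))//; last first.
    by move=> phi psi h; rewrite (cod_depends h).
  over.
apply: le_trans (avg_nu_ln_cod_ge An); rewrite addr_ge0//.
  by apply: avg_ge0 => phi; rewrite ent_ge0// mu_ge0.
by rewrite mulr_ge0// deg_ent_ge0.
Qed.

(** The right side is [nu B] times [(deg / p)^(|B| - 1)] and the normalised codegrees;
    [z >= 1 + ln z] is applied to what multiplies [nu B]. A positive star on [B] makes every
    codegree of the list positive, so the logarithm splits into a sum. *)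
Lemma prod_cod_ge (L : seq {set I}) B x phi : B != finset.set0 ->
  {in L, forall A, A \subset B} ->
  nu B x phi + (#|B|.-1)%:R * (nu B x phi * ln (deg x / p))
    + \sum_(A <- L) nu B x phi * ln (cod A phi / p ^+ #|A|)
  <= star B x phi * \prod_(A <- L) cod A phi
       / p ^+ (#|B| + \sum_(A <- L) #|A|)%N.
Proof.
move=> Bn LB; case: (star_eqVgt0 B x phi) => [s0|s0].
  rewrite /nu s0 !mul0r mulr0 !add0r big1// => A _.
  by rewrite !mul0r.
have d0 := star_deg_gt0 Bn s0.
have n0 := star_nu_gt0 Bn s0.
have dp0 : 0 < deg x / p by rewrite divr_gt0.
set P := \prod_(A <- L) (cod A phi / p ^+ #|A|).
have [P0 lnP] : 0 < P /\ ln P = \sum_(A <- L) ln (cod A phi / p ^+ #|A|).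
  rewrite /P {P}; elim: L LB => [|A L IH] LB; first by rewrite !big_nil ln1.
  have [|P0 PE] := IH; first by move=> C CL; rewrite LB// inE CL orbT.
  have cA : 0 < cod A phi / p ^+ #|A|.
    rewrite divr_gt0 ?exprn_gt0//; apply: (@star_cod_gt0 A x).
    by apply: star_sub_gt0 s0; rewrite LB// mem_head.
  by rewrite !big_cons lnM ?posrE// PE mulr_gt0.
have -> : star B x phi * (\prod_(A <- L) cod A phi)
    / p ^+ (#|B| + \sum_(A <- L) #|A|)%N
  = nu B x phi * ((deg x / p) ^+ #|B|.-1 * P).
  rewrite /P big_split/= prodfV -expr_sum exprD.
  set b := #|B|.-1; have -> : #|B| = b.+1 by rewrite prednK// card_gt0.
  rewrite /nu /= -/b exprMn exprVn exprS; field.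
  by rewrite !expf_neq0 ?(gt_eqF d0) ?(gt_eqF p_gt0).
have := @ln_le_sub1 _ ((deg x / p) ^+ #|B|.-1 * P).
rewrite mulr_gt0 ?exprn_gt0// => /(_ isT).
rewrite lnM ?posrE ?exprn_gt0// lnXn// lnP -mulr_natr -(ler_pM2l n0).
rewrite -mulr_sumr; lra.
Qed.

(* Stability version of the Sidorenko inequality for a bipartite graph two of
whose vertices have neighbourhood [B], the other neighbourhoods being listed
in [L]. *)
Lemma avg_prod_cod_ge (L : seq {set I}) B : B != finset.set0 ->
  {in L, forall A, A \subset B} ->
  1 + (#|B|.-1)%:R * deg_ent + \avg_(phi) ent (mu B phi) <=
  (\avg_(phi) (cod B phi * \prod_(A <- B :: L) cod A phi))
    / p ^+ (#|B| + \sum_(A <- B :: L) #|A|)%N.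
Proof.
move=> Bn LB; rewrite -avgZr.
(* The leading [cod B phi] is opened into an average over [x], the vertex that tilts the measure.
   The copy of [B] heading the list remains a codegree and later supplies the entropy of [mu B]. *)
under [leRHS]eq_avg => phi do rewrite -!avgZr.
rewrite exchange_avg.
have LB' : {in B :: L, forall A, A \subset B}.
  by move=> A; rewrite inE => /predU1P[->//|/LB].
have h := ler_avg (fun x => ler_avg (fun phi => prod_cod_ge x phi Bn LB')).
apply: le_trans h.
under [leRHS]eq_avg => x do rewrite avgD avgD avgZl avg_sum.
rewrite avgD avgD avgZl avg_sum avg_avg_nu// avg_nu_ln_deg// big_cons.
have := avg_nu_ln_cod_ge Bn.
have : 0 <= \sum_(A <- L) \avg_(x) \avg_(phi)
    (nu B x phi * ln (cod A phi / p ^+ #|A|)).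
  rewrite big_seq sumr_ge0// => A /LB AB; exact: avg_nu_ln_cod_sub.
have : 0 <= (#|B|.-1)%:R * deg_ent by rewrite mulr_ge0// deg_ent_ge0.
lra.
Qed.

(** * L1 estimates from small entropy *)

(** Passing to a marginal cannot increase the L1 distance to the uniform law: the sign of [mu A - 1]
    depends only on the coordinates in [A], so [mu A] and [mu B] have the same average against
    it. *)
Lemma avg_abs_mu_sub A B : A != finset.set0 -> A \subset B ->
  \avg_(phi) `|mu A phi - 1| <= \avg_(phi) `|mu B phi - 1|.
Proof.
move=> An AB.
have Bn : B != finset.set0.
  by apply: contraNneq An => B0; rewrite -finset.subset0 -B0.
pose sg phi : R := Num.sg (mu A phi - 1).
have sgA : depends_on A sg by move=> phi psi h; rewrite /sg (mu_depends h).
have muE C : \avg_(phi) (mu C phi * sg phi) =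
    \avg_(x) \avg_(phi) (nu C x phi * sg phi).
  by rewrite exchange_avg; apply: eq_avg => phi; rewrite avgZr.
have -> : \avg_(phi) `|mu A phi - 1| = \avg_(phi) ((mu B phi - 1) * sg phi).
  transitivity (\avg_(phi) ((mu A phi - 1) * sg phi)).
    by apply: eq_avg => phi; rewrite mulrC -normrEsg.
  have subE C : \avg_(phi) ((mu C phi - 1) * sg phi) =
      \avg_(phi) (mu C phi * sg phi) - avg sg.
    by rewrite -avgB; apply: eq_avg => phi; ring.
  rewrite !subE !muE; congr (_ - _).
  by apply: eq_avg => x; rewrite (avg_nu_mul x An AB sgA).
apply: le_trans (ler_norm _) (le_trans (ler_norm_avg _) _).
apply: ler_avg => phi; rewrite normrM ler_piMr//.
by rewrite normr_sg lern1 leq_b1.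
Qed.

Lemma avg_abs_deg_sub (d : R) : 0 < d -> deg_ent <= d ^+ 2 ->
  \avg_(x) `|deg x - p| <= 3 * d.
Proof.
move=> d0 hd.
have h : \avg_(x) `|deg x / p - 1| <= 3 * d.
  apply: avg_abs_sub1_le_ent => //; last exact: avg_deg_div.
  by move=> x; rewrite divr_ge0 ?deg_ge0// ltW.
apply: le_trans h; apply: ler_avg => x.
have -> : deg x / p - 1 = (deg x - p) / p by rewrite mulrBl mulfV ?gt_eqF.
rewrite normrM ler_peMr// normfV gtr0_norm//.
by rewrite invf_ge1// dens_le1.
Qed.

(** For the pair [A] formed by [a] and [b], the codegree minus [p ^+ 2] is the average of
    [star * (1 - p / deg)] plus [p ^+ 2 * (mu A - 1)]. Degrees close to [p] control the first term,
    the marginal of [mu B] the second; each costs [3 * d]. *)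
Lemma avg_abs_cod_sub (d : R) B a b : a != b -> a \in B -> b \in B ->
  0 < d -> deg_ent <= d ^+ 2 -> \avg_(phi) ent (mu B phi) <= d ^+ 2 ->
  \avg_(y) \avg_(z) `|(\avg_(x) (f x y * f x z)) - p ^+ 2| <= 6 * d.
Proof.
move=> ab aB bB d0 hd hB.
rewrite -(avg_coord2 T0 (fun y z => `|(\avg_(x) (f x y * f x z)) - p ^+ 2|) ab).
set A := a |: [set b]%SET.
have An : A != finset.set0 by apply/set0Pn; exists a; rewrite !inE eqxx.
have Bn : B != finset.set0 by apply/set0Pn; exists a.
have AB : A \subset B.
  by apply/fintype.subsetP => i; rewrite !inE => /orP[]/eqP->.
have cA : #|A| = 2 by rewrite cards2 ab.
have starE x phi : star A x phi = f x (phi a) * f x (phi b).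
  by rewrite /star big_setU1/= ?inE// big_set1.
have mu3 : \avg_(phi) `|mu A phi - 1| <= 3 * d.
  apply: le_trans (avg_abs_mu_sub An AB) _; apply: avg_abs_sub1_le_ent => //.
  - exact: card_ffun_gt0.
  - by move=> phi; exact: mu_ge0.
  - exact: avg_mu.
apply: (@le_trans _ _ (\avg_(phi) ((\avg_(x) (star A x phi * `|1 - p / deg x|))
    + `|mu A phi - 1|))).
  apply: ler_avg => phi.
  under eq_avg => x do rewrite -starE.
  have -> : avg (star A ^~ phi) - p ^+ 2 =
      \avg_(x) (star A x phi * (1 - p / deg x)) + p ^+ 2 * (mu A phi - 1).
    rewrite mulrBr mulr1 addrA; congr (_ - _); rewrite /mu -avgZl -avgD.
    apply: eq_avg => x; rewrite /nu cA expr1.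
    have [d0'|dn] := eqVneq (deg x) 0; first by rewrite star_deg0//; ring.
    by field; rewrite dn gt_eqF.
  apply: le_trans (ler_normD _ _) _; apply: lerD.
    apply: le_trans (ler_norm_avg _) _; apply: ler_avg => x.
    by rewrite normrM ger0_norm// star_ge0.
  rewrite normrM ler_piMl// ger0_norm ?exprn_ge0// ?(ltW p_gt0)//.
  by rewrite exprn_ile1 ?dens_le1// ltW.
rewrite avgD exchange_avg.
suff : \avg_(x) \avg_(phi) (star A x phi * `|1 - p / deg x|) <= 3 * d by lra.
(* The star averages to [deg x ^+ 2], which absorbs the division by [deg x]. *)
apply: le_trans (avg_abs_deg_sub d0 hd); apply: ler_avg => x.
rewrite avgZr avg_star cA.
have [->|dn] := eqVneq (deg x) 0; first by rewrite expr0n mul0r.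
have -> : deg x ^+ 2 * `|1 - p / deg x| = deg x * `|deg x - p|.
  have : `|deg x ^+ 2 * (1 - p / deg x)| = `|deg x * (deg x - p)|.
    by congr (`| _ |); field.
  rewrite normrM [in RHS]normrM (ger0_norm (exprn_ge0 2 (deg_ge0 x))).
  by rewrite (ger0_norm (deg_ge0 x)).
by rewrite ler_piMl// deg_le1.
Qed.

(** * Integrating out an independent set *)

(** No neighbourhood meets [r], so resampling the coordinate [w] affects only its own star and turns
    it into a codegree. [Q] collects the codegrees already produced. *)
Lemma avg_prod_star (r : seq I) (N : I -> {set I}) (Q : {ffun I -> T} -> R) :
  uniq r -> {in r &, forall v w, v \notin N w} ->
  depends_on [set i | i \notin r]%SET Q ->
  \avg_(phi) (Q phi * \prod_(w <- r) star (N w) (phi w) phi) =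
  \avg_(phi) (Q phi * \prod_(w <- r) cod (N w) phi).
Proof.
elim: r Q => [|w r IH] Q /=; first by move=> *; apply: eq_avg => phi; rewrite !big_nil.
move=> /andP[wr ur] rN Qr.
transitivity (\avg_(phi) ((Q phi * cod (N w) phi)
    * \prod_(v <- r) star (N v) (phi v) phi)).
  rewrite (avg_upd T0 w); apply: eq_avg => phi.
  transitivity (\avg_(x) (star (N w) x phi *
      (Q phi * \prod_(v <- r) star (N v) (phi v) phi))); last first.
    by rewrite avgZr /cod; ring.
  apply: eq_avg => x; rewrite big_cons updE (depends_upd _ _ Qr); last first.
    by rewrite inE mem_head.
  rewrite (depends_upd _ _ (@star_depends (N w) x)) ?rN ?mem_head// mulrCA.
  congr (_ * (_ * _)); rewrite big_seq [RHS]big_seq; apply: eq_bigr => v vr.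
  rewrite upd_neq; last by apply: contraNneq wr => <-.
  by rewrite (depends_upd _ _ (@star_depends (N v) _)) ?rN ?mem_head// inE vr orbT.
rewrite IH//; last 2 first.
- by move=> v1 v2 h1 h2; rewrite rN// inE ?h1 ?h2 orbT.
- move=> phi psi h; rewrite (Qr phi psi) => [|i]; last first.
    by rewrite inE inE negb_or => /andP[_ ir]; apply: h; rewrite inE.
  rewrite (cod_depends (psi := psi) (A := N w))// => i iN; apply: h; rewrite inE.
  by apply: contraL iN => ir; rewrite rN ?mem_head// inE ir orbT.
by apply: eq_avg => phi; rewrite big_cons mulrA.
Qed.

End Stars.

(** * Counting lemma *)

(** Cauchy-Schwarz in [x] removes [a]; expanding the square leaves correlations of [f - p] over
    pairs [y], [z], which are codegree deviations corrected by two degree deviations. *)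
Lemma avg_cut_le (e : R) (a b : T -> R) : 0 < e ->
  (forall x, 0 <= a x <= 1) -> (forall x, 0 <= b x <= 1) ->
  \avg_(x) `|deg x - p| <= 3 * e ^+ 2 ->
  \avg_(y) \avg_(z) `|(\avg_(x) (f x y * f x z)) - p ^+ 2| <= 6 * e ^+ 2 ->
  `|\avg_(x) \avg_(y) ((f x y - p) * (a x * b y))| <= 4 * e.
Proof.
move=> e0 a01 b01 hdeg hcod.
under eq_avg => x do under eq_avg => y do rewrite mulrCA.
under eq_avg => x do rewrite avgZl.
apply: avg_mul_le; first by rewrite mulr_gt0.
  by move=> x; have /andP[? ?] := a01 x; rewrite ger0_norm.
have -> : \avg_(x) ((\avg_(y) ((f x y - p) * b y)) ^+ 2) =
    \avg_(y) \avg_(z) (b y * b z * \avg_(x) ((f x y - p) * (f x z - p))).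
  transitivity (\avg_(x) \avg_(y) \avg_(z)
      (b y * b z * ((f x y - p) * (f x z - p)))).
    apply: eq_avg => x; rewrite expr2 -avgZr; apply: eq_avg => y.
    by rewrite -avgZl; apply: eq_avg => z; ring.
  rewrite exchange_avg; apply: eq_avg => y; rewrite exchange_avg.
  by apply: eq_avg => z; rewrite avgZl.
apply: (@le_trans _ _ (\avg_(y) \avg_(z)
   (`|(\avg_(x) (f x y * f x z)) - p ^+ 2| + `|deg y - p| + `|deg z - p|))).
  apply: ler_avg => y; apply: ler_avg => z.
  have [/andP[by0 by1] /andP[bz0 bz1]] := (b01 y, b01 z).
  apply: le_trans (ler_norm _) _.
  rewrite normrM ger0_norm ?mulr_ge0//.
  apply: (@le_trans _ _ `|\avg_(x) ((f x y - p) * (f x z - p))|).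
    by rewrite ler_piMl// mulr_ile1.
  have -> : \avg_(x) ((f x y - p) * (f x z - p)) =
     (\avg_(x) (f x y * f x z)) - p ^+ 2 - p * (deg y - p) - p * (deg z - p).
    transitivity (\avg_(x) (f x y * f x z - p * f x z - p * f x y + p ^+ 2)).
      by apply: eq_avg => x; ring.
    rewrite avgD !avgB !avgZl avg_cst// /deg.
    under [avg (f ^~ z)]eq_avg => x do rewrite f_sym.
    under [avg (f ^~ y)]eq_avg => x do rewrite f_sym.
    by ring.
  apply: le_trans (ler_normB _ _) _; apply: lerD.
    apply: le_trans (ler_normB _ _) _; apply: lerD => //.
    by rewrite normrM ler_piMl// ger0_norm ?dens_le1 ?ltW.
  by rewrite normrM ler_piMl// ger0_norm ?dens_le1 ?ltW.
under eq_avg => y do rewrite avgD avgD avg_cst//.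
rewrite avgD avgD avg_cst//.
(* The three deviations cost [6 + 3 + 3 = 12] times [e ^+ 2], within the 16 available. *)
have -> : (4 * e) ^+ 2 = 16 * e ^+ 2 by ring.
have := exprn_ge0 2 (ltW e0); lra.
Qed.

(** With all coordinates other than [u] and [v] frozen, [a] is a function of the value at [u] and
    [b] of the value at [v], so the cut bound applies. *)
Lemma avg_cut_ffun_le (I : finType) (e : R) (u v : I)
    (a b : {ffun I -> T} -> R) : 0 < e -> u != v ->
  (forall phi, 0 <= a phi <= 1) -> (forall phi, 0 <= b phi <= 1) ->
  depends_on (~: [set v]%SET) a -> depends_on (~: [set u]%SET) b ->
  \avg_(x) `|deg x - p| <= 3 * e ^+ 2 ->
  \avg_(y) \avg_(z) `|(\avg_(x) (f x y * f x z)) - p ^+ 2| <= 6 * e ^+ 2 ->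
  `|\avg_(phi : {ffun I -> T}) ((f (phi u) (phi v) - p) * (a phi * b phi))| <= 4 * e.
Proof.
move=> e0 uv a01 b01 av bu hdeg hcod.
rewrite (avg_upd T0 u) (avg_upd T0 v) -[leRHS](avg_cst _ (card_ffun_gt0 I T0)).
apply: le_trans (ler_norm_avg _) _; apply: ler_avg => phi.
rewrite exchange_avg.
have := avg_cut_le e0 (fun x => a01 (upd phi u x)) (fun y => b01 (upd phi v y))
  hdeg hcod.
congr (`| _ | <= _); apply: eq_avg => x; apply: eq_avg => y.
rewrite updE upd_neq 1?eq_sym// updE; congr (_ * (_ * _)).
  apply: av => i; rewrite !inE => iv; rewrite !ffunE.
  by case: eqP => // _; rewrite (negPf iv).
by apply: bu => i; rewrite !inE => iu; rewrite [in RHS]upd_neq.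
Qed.

Definition hom_weight (I : finType) (L : seq (I * I)) (phi : {ffun I -> T}) : R :=
  \prod_(q <- L) f (phi q.1) (phi q.2).

(** Telescoping: the edges are replaced by the constant [p] one at a time, each at the cost of one
    cut bound. *)
Lemma counting_lemma (I : finType) (e : R) (L : seq (I * I)) : 0 < e ->
  \avg_(x) `|deg x - p| <= 3 * e ^+ 2 ->
  \avg_(y) \avg_(z) `|(\avg_(x) (f x y * f x z)) - p ^+ 2| <= 6 * e ^+ 2 ->
  all (fun q => q.1 != q.2) L -> uniq [seq [set q.1; q.2]%SET | q <- L] ->
  `|avg (hom_weight L) - p ^+ size L| <= (size L)%:R * (4 * e).
Proof.
move=> e0 hdeg hcod; elim: L => [_ _|[u v] L IH /= /andP[uv nL] /andP[uvL uL]].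
  rewrite (eq_avg (K := fun=> 1)); last by move=> phi; rewrite /hom_weight big_nil.
  by rewrite avg_cst ?card_ffun_gt0// subrr normr0 mul0r.
have w01 (P : pred (I * I)) phi :
    0 <= \prod_(q <- L | P q) f (phi q.1) (phi q.2) <= 1.
  apply: (big_ind (fun z => 0 <= z <= 1)); rewrite ?ler01 ?lexx//.
    by move=> y z /andP[? ?] /andP[? ?]; rewrite mulr_ge0//= mulr_ile1.
  by move=> q _; rewrite f_ge0 f_le1.
have -> : avg (hom_weight ((u, v) :: L)) - p ^+ (size L).+1 =
    \avg_(phi : {ffun I -> T}) ((f (phi u) (phi v) - p) * hom_weight L phi)
    + p * (avg (hom_weight L) - p ^+ size L).
  rewrite exprS mulrBr addrA -avgZl -avgD; congr (_ - _).
  by apply: eq_avg => phi; rewrite /hom_weight big_cons /=; ring.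
rewrite -natr1 mulrDl mul1r [leRHS]addrC.
apply: le_trans (ler_normD _ _) _; apply: lerD; last first.
  rewrite normrM; apply: le_trans (IH nL uL).
  by rewrite ler_piMl// ger0_norm ?dens_le1 ?ltW.
(* The remaining edges are split by whether they contain [v]. Those that do cannot contain [u] as
   well, since the edge on [u] and [v] occurs only once. *)
pose hasv (q : I * I) := v \in [set q.1; q.2]%SET.
under eq_avg => phi do rewrite /hom_weight (bigID hasv)/= mulrC.
under eq_avg => phi do rewrite mulrC [X in _ * X]mulrC.
apply: (avg_cut_ffun_le e0 uv) => //.
- move=> phi psi h; apply: eq_bigr => q; rewrite /hasv !inE negb_or => /andP[v1 v2].
  by rewrite !h// !inE eq_sym.
- move=> phi psi h; rewrite big_seq_cond [RHS]big_seq_cond.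
  apply: eq_bigr => q /andP[qL vq].
  suff uq : u \notin [set q.1; q.2]%SET.
    move: uq; rewrite !inE negb_or => /andP[u1 u2].
    by rewrite !h// !inE eq_sym.
  apply: contra uvL => uq; apply/mapP; exists q => //=.
  move: uq vq uv; rewrite /hasv !inE => /orP[]/eqP-> /orP[]/eqP->; rewrite ?eqxx//.
  by rewrite finset.setUC.
Qed.

End Kernel.

(** * Graphs *)

Definition adj (R : realType) (G : sgraph) (x y : G) : R := (sadj x y)%:R.
Arguments adj R G x y : clear implicits.

Lemma prodr_natb (R : realType) (I : Type) (r : seq I) (P b : pred I) :
  \prod_(i <- r | P i) (b i)%:R = (all (fun i => P i ==> b i) r)%:R :> R.
Proof.
elim: r => [|i r IH]; first by rewrite big_nil.
by rewrite big_cons /= IH; case: (P i) => //=; case: (b i); rewrite ?mul1r ?mul0r.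
Qed.

Lemma tdensE (R : realType) (F G : sgraph) :
  tdens R F G = \avg_(phi : {ffun F -> G}) (is_hom phi)%:R.
Proof.
rewrite avg.unlock /tdens /hom_count card_ffun; congr (_ / _).
rewrite -sum1_card natr_sum big_mkcond; apply: eq_bigr => phi _.
by rewrite inE; case: is_hom.
Qed.

(** Enumeration ranks select one orientation of each edge, so that a product over this set takes
    every edge once. *)
Definition oriented_edges (F : sgraph) : {set F * F} :=
  [set q : F * F | sadj q.1 q.2 && (enum_rank q.1 < enum_rank q.2)%N]%SET.

Lemma oriented_edges_inj (F : sgraph) :
  {in oriented_edges F &, injective (fun q : F * F => [set q.1; q.2]%SET)}.
Proof.
move=> [a b] [c d]; rewrite !inE /= => /andP[_ ab] /andP[_ cd] /setP E.
have := E a; have := E b; rewrite !inE !eqxx orbT /=.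
move=> /esym/orP[]/eqP bE /esym/orP[]/eqP aE; move: ab cd; rewrite aE bE ?ltnn//.
by move=> h1 h2; have := ltn_trans h1 h2; rewrite ltnn.
Qed.

Lemma card_oriented_edges (F : sgraph) : #|oriented_edges F| = nedges F.
Proof.
rewrite -(card_in_imset (@oriented_edges_inj F)); apply: eq_card => e.
apply/finset.imsetP/idP => [[[x y] /[!inE]/= /andP[xy _] ->]|].
  by apply/existsP; exists x; apply/existsP; exists y; rewrite xy eqxx.
rewrite inE => /existsP[x /existsP[y /andP[xy /eqP ->]]].
have [h|h|/val_inj/enum_rank_inj xyE] := ltngtP (enum_rank x) (enum_rank y).
- by exists (x, y) => //; rewrite inE /= xy h.
- by exists (y, x); [rewrite inE /= sadj_sym xy h|rewrite finset.setUC].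
- by move: xy; rewrite xyE sadj_irr.
Qed.

Lemma is_hom_oriented (F G : sgraph) (phi : {ffun F -> G}) :
  is_hom phi =
  all (fun q => sadj (phi q.1) (phi q.2)) (enum (oriented_edges F)).
Proof.
apply/idP/allP => [/forallP h [x y]|h].
  rewrite mem_enum inE /= => /andP[xy _].
  by have /forallP/(_ y)/implyP/(_ xy) := h x.
apply/forallP => x; apply/forallP => y; apply/implyP => xy.
have [l|l|/val_inj/enum_rank_inj xyE] := ltngtP (enum_rank x) (enum_rank y).
- by apply: (h (x, y)); rewrite mem_enum inE /= xy l.
- by rewrite sadj_sym; apply: (h (y, x)); rewrite mem_enum inE /= sadj_sym xy l.
- by move: xy; rewrite xyE sadj_irr.
Qed.

Lemma tdens_hom_weight (R : realType) (F G : sgraph) :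
  tdens R F G = avg (hom_weight (adj R G) (enum (oriented_edges F))).
Proof.
rewrite tdensE; apply: eq_avg => phi.
by rewrite is_hom_oriented /hom_weight prodr_natb.
Qed.

Lemma tdens_K2 (R : realType) (G : sgraph) :
  (0 < #|G|)%N -> tdens R K2 G = dens (adj R G).
Proof.
move=> G0; rewrite tdensE.
rewrite -[RHS](@avg_coord2 R bool G G0 true false (adj R G))//.
apply: eq_avg => phi; rewrite /adj; congr (_ %:R).
congr nat_of_bool; apply/idP/idP => [/forallP/(_ true)/forallP/(_ false)//|h].
apply/forallP => -[]; apply/forallP => -[]; apply/implyP => //= _.
by rewrite sadj_sym.
Qed.

(** * Homomorphism densities of bipartite graphs *)

Section Bipartite.
Variables (R : realType) (H : sgraph) (V1 : {set H}).
Hypothesis V1_bip : forall x y : H, sadj x y -> (x \in V1) != (y \in V1).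

Definition nbhd (w : H) : {set H} := [set j | sadj w j]%SET.

Lemma nbhd_sub w : w \in V1 -> nbhd w \subset ~: V1.
Proof.
move=> wV; apply/fintype.subsetP => j; rewrite !inE => /V1_bip.
by rewrite wV; case: (j \in V1).
Qed.

(** Every edge has exactly one endpoint in [V1] and is counted there. *)
Lemma nedges_bip : nedges H = (\sum_(w <- enum V1) #|nbhd w|)%N.
Proof.
pose D := [set q : H * H | (q.1 \in V1) && sadj q.1 q.2]%SET.
have inj : {in D &, injective (fun q : H * H => [set q.1; q.2]%SET)}.
  move=> [a b] [c d]; rewrite !inE /= => /andP[aV ab] /andP[cV cd] /setP E.
  have bV : b \notin V1 by have := V1_bip ab; rewrite aV; case: (b \in V1).
  have dV : d \notin V1 by have := V1_bip cd; rewrite cV; case: (d \in V1).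
  have := E a; have := E b; rewrite !inE !eqxx orbT /=.
  move=> /esym/orP[]/eqP bE /esym/orP[]/eqP aE.
  - by move: bV; rewrite bE cV.
  - by move: bV; rewrite bE cV.
  - by rewrite aE bE.
  - by move: dV; rewrite -aE aV.
transitivity #|D|.
  rewrite -(card_in_imset inj); apply: eq_card => e.
  apply/idP/finset.imsetP => [|[[x y] /[!inE]/= /andP[_ xy] ->]]; last first.
    by apply/existsP; exists x; apply/existsP; exists y; rewrite xy eqxx.
  rewrite inE => /existsP[x /existsP[y /andP[xy /eqP ->]]].
  have := V1_bip xy; case xV : (x \in V1) => yV.
    by exists (x, y) => //; rewrite inE /= xV xy.
  exists (y, x); last by rewrite finset.setUC.
  by rewrite inE /= sadj_sym xy andbT; case: (y \in V1) yV.
rewrite big_enum /= -sum1_card.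
under [RHS]eq_bigr => w _ do rewrite -sum1_card.
by rewrite pair_big_dep /=; apply: eq_bigl => -[x y]; rewrite !inE.
Qed.

Lemma is_hom_bip (G : sgraph) (phi : {ffun H -> G}) :
  (is_hom phi)%:R =
  \prod_(w <- enum V1) star (adj R G) (nbhd w) (phi w) phi :> R.
Proof.
under eq_bigr => w _ do rewrite /star /adj prodr_natb.
rewrite prodr_natb; congr (_ %:R); congr nat_of_bool.
apply/idP/allP => [/forallP h w _|h].
  by apply/allP => j _; apply/implyP; rewrite inE; have /forallP/(_ j)/implyP := h w.
have h1 x y : x \in V1 -> sadj x y -> sadj (phi x) (phi y).
  move=> xV xy; have := h x; rewrite mem_enum => /(_ xV)/allP/(_ y).
  by rewrite mem_index_enum inE xy => /(_ isT).
apply/forallP => x; apply/forallP => y; apply/implyP => xy.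
case xV : (x \in V1); first exact: h1.
rewrite sadj_sym h1// 1?sadj_sym//.
by have := V1_bip xy; rewrite xV; case: (y \in V1).
Qed.

Lemma tdens_bip (G : sgraph) : (0 < #|G|)%N ->
  tdens R H G =
  \avg_(phi : {ffun H -> G}) \prod_(w <- enum V1) cod (adj R G) (nbhd w) phi.
Proof.
move=> G0; rewrite tdensE.
transitivity (\avg_(phi : {ffun H -> G}) (1 * \prod_(w <- enum V1)
    star (adj R G) (nbhd w) (phi w) phi)).
  by apply: eq_avg => phi; rewrite mul1r is_hom_bip.
rewrite avg_prod_star ?enum_uniq//; last first.
  move=> v w; rewrite !mem_enum => vV /nbhd_sub/fintype.subsetP/(_ v).
  by rewrite finset.in_setC vV; case: (v \in nbhd w) => // /(_ isT).
by apply: eq_avg => phi; rewrite mul1r.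
Qed.

End Bipartite.

(** * Stability for a single graph *)

(** The excess bounds both entropies by [(e ^+ 2) ^+ 2]. The Pinsker step takes one square root,
    giving L1 deviations of order [e ^+ 2]; Cauchy-Schwarz takes another, giving cuts of order
    [e]. *)
Lemma tdens_stability (R : realType) (H : sgraph) (V1 : {set H}) (G : sgraph)
    (e : R) :
  (forall x y : H, sadj x y -> (x \in V1) != (y \in V1)) ->
  (2 <= #|~: V1|)%N ->
  (exists u v : H, [/\ u != v, u \in V1, v \in V1 &
     forall w : H, w \notin V1 -> sadj u w && sadj v w]) ->
  (0 < #|G|)%N -> 0 < tdens R K2 G -> 0 < e ->
  tdens R H G / tdens R K2 G ^+ nedges H <= 1 + (e ^+ 2) ^+ 2 ->
  forall F : sgraph,
    `|tdens R F G - tdens R K2 G ^+ nedges F| <= (nedges F)%:R * (4 * e).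
Proof.
move=> bip B2 [u [v [uv uV vV full]]] G0; rewrite tdens_K2//.
set f := adj R G => p0 e0 tH F.
have f0 x y : 0 <= f x y by [].
have f1 x y : f x y <= 1 by rewrite lern1 leq_b1.
have fs x y : f x y = f y x by rewrite /f /adj sadj_sym.
set B := ~: V1.
have [a [b [aB bB ab]]] : exists a b, [/\ a \in B, b \in B & a != b].
  exact/card_gt1P.
have Bn : B != finset.set0 by apply/set0Pn; exists a.
have nB w : w \in V1 -> {in B, forall j, sadj w j} -> nbhd w = B.
  move=> wV wB; apply/eqP; rewrite finset.eqEsubset nbhd_sub//=.
  by apply/fintype.subsetP => j /wB; rewrite inE.
have uB : nbhd u = B by apply: nB => // j; rewrite inE => /full/andP[].
have vB : nbhd v = B by apply: nB => // j; rewrite inE => /full/andP[].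
pose L := [seq nbhd w | w <- enum (V1 :\ u :\ v)].
have LB : {in L, forall A : {set H}, A \subset B}.
  move=> A /mapP[w]; rewrite mem_enum !inE => /and3P[_ _ wV] ->.
  exact: nbhd_sub.
have sumL : (#|B| + \sum_(A <- B :: L) #|A|)%N = nedges H.
  rewrite (nedges_bip bip) big_cons big_map !big_enum /=.
  rewrite [(\sum_(i in V1) _)%N](big_setD1 u)//=.
  rewrite [(\sum_(i in V1 :\ u) _)%N](big_setD1 v)/= ?uB ?vB ?addnA//.
  by rewrite !inE eq_sym uv.
have prodL : tdens R H G =
    \avg_(phi) (cod f B phi * \prod_(A <- B :: L) cod f A phi).
  rewrite (tdens_bip _ bip)//; apply: eq_avg => phi.
  rewrite big_cons big_map !big_enum /=.
  rewrite [\prod_(i in V1) _](big_setD1 u)//= [\prod_(i in V1 :\ u) _](big_setD1 v)/= ?uB ?vB //.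
  by rewrite !inE eq_sym uv.
have := avg_prod_cod_ge G0 f0 p0 Bn LB.
rewrite sumL -prodL => h.
have K0 : 0 <= deg_ent f by exact: deg_ent_ge0.
have M0 : 0 <= \avg_(phi) ent (mu f B phi).
  by apply: avg_ge0 => phi; rewrite ent_ge0// mu_ge0.
(* Here [|B| >= 2] makes the coefficient of the degree entropy at least 1. *)
have K1 : deg_ent f <= (#|B|.-1)%:R * deg_ent f.
  by rewrite ler_peMl// ler1n -ltnS prednK// (ltn_trans _ B2).
have e2 : 0 < e ^+ 2 by rewrite exprn_gt0.
have := le_trans h tH; rewrite -addrA lerD2l => hs.
have hK : deg_ent f <= (e ^+ 2) ^+ 2.
  by apply: le_trans K1 (le_trans _ hs); rewrite lerDl.
have hM : \avg_(phi) ent (mu f B phi) <= (e ^+ 2) ^+ 2.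
  by apply: le_trans hs; rewrite lerDr (le_trans K0).
have sE : size (enum (oriented_edges F)) = nedges F.
  by rewrite -cardE card_oriented_edges.
rewrite tdens_hom_weight -sE; apply: counting_lemma => //.
- exact: avg_abs_deg_sub.
- exact: avg_abs_cod_sub ab aB bB e2 hK hM.
- apply/allP => q; rewrite mem_enum inE => /andP[_].
  by apply: contraTneq => ->; rewrite ltnn.
- rewrite map_inj_in_uniq ?enum_uniq// => q q'; rewrite !mem_enum.
  exact: oriented_edges_inj.
Qed.

(** * Passage to the limit *)

Lemma eq_seq_cvg (R : realType) (u v : nat -> R) (l : R) :
  u =1 v -> (u @ \oo --> l -> v @ \oo --> l)%classic.
Proof. by move=> /funext ->. Qed.

Theorem theorem1p6 (R : realType) (H : sgraph) (V1 : {set H}) :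
  (* (V1, ~: V1) is a bipartition of H: every edge joins V1 to its complement *)
  (forall x y : H, sadj x y -> (x \in V1) != (y \in V1)) ->
  (2 <= #|~: V1|)%N ->
  (exists u v : H, [/\ u != v, u \in V1, v \in V1 &
     forall w : H, w \notin V1 -> sadj u w && sadj v w]) ->
  forcing R H.
Proof.
move=> bip B2 full p /andP[p0 p1] G Goo hK hH F.
(* The stability bound is relative to the actual edge density of each graph, so densities are first
   compared with powers of [q n], which converge to powers of [p]. *)
pose q n : R := tdens R K2 (G n).
have q_cvg : (q @ \oo --> p)%classic.
  have h : ((fun n => q n / p * p) @ \oo --> 1 * p)%classic.
    by apply: cvgM hK _; exact: cvg_cst.
  rewrite mul1r in h; apply: eq_seq_cvg h => n.
  by rewrite divfK// gt_eqF.
have qX_cvg k : ((fun n => q n ^+ k) @ \oo --> p ^+ k)%classic.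
  elim: k => [|k IH].
    by under eq_fun do rewrite expr0; exact: cvg_cst.
  by under eq_fun do rewrite exprS; rewrite exprS; exact: cvgM.
set m := nedges H; set k := nedges F.
have pX n : p ^+ n != 0 by rewrite expf_neq0// gt_eqF.
have ratio_cvg : ((fun n => tdens R H (G n) / q n ^+ m) @ \oo --> (1 : R))%classic.
  have h : ((fun n => tdens R H (G n) / p ^+ m * p ^+ m * (q n ^+ m)^-1) @ \oo
      --> 1 * p ^+ m * (p ^+ m)^-1)%classic.
    apply: cvgM; first by apply: cvgM hH _; exact: cvg_cst.
    exact: cvgV.
  rewrite mul1r mulfV// in h; apply: eq_seq_cvg h => n.
  by rewrite divfK.
have tF_cvg : ((fun n => tdens R F (G n) - q n ^+ k) @ \oo --> (0 : R))%classic.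
  apply/cvgrPdist_le => eps eps0.
  (* This makes the error [k * (4 * e)] at most [eps]; the successor keeps the divisor positive when
     [F] has no edge. *)
  pose e := eps / (4 * k.+1%:R).
  have e0 : 0 < e by rewrite divr_gt0// mulr_gt0.
  have [M hM] := Goo 1%N.
  near=> n.
  have G0 : (0 < #|G n|)%N by apply: hM; near: n; exact: nbhs_infty_ge.
  have q0 : 0 < q n by near: n; exact: cvgr_gt q_cvg _ p0.
  rewrite sub0r normrN.
  apply: le_trans (tdens_stability bip B2 full G0 q0 e0 _ F) _.
    near: n; apply: cvgr_le ratio_cvg _ _.
    by rewrite ltrDl !exprn_gt0.
  rewrite -/k /e mulrCA mulrA [_ * (eps / _)]mulrC.
  rewrite -mulrA ler_piMr ?(ltW eps0)//.
  rewrite invfM mulrACA mulVf// mul1r mulrC ler_pdivrMr// mul1r ler_nat.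
  exact: leqnSn.
rewrite /asymp_dens.
have h : ((fun n => (tdens R F (G n) - q n ^+ k + q n ^+ k) * (p ^+ k)^-1) @ \oo
    --> (0 + p ^+ k) * (p ^+ k)^-1)%classic.
  by apply: cvgM; [apply: cvgD|exact: cvg_cst].
rewrite add0r mulfV// in h; apply: eq_seq_cvg h => n.
by rewrite subrK.
Unshelve. all: by end_near.
Qed.
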